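(* Let $X$ be a positive definite metric space. Then for any nonempty $Y\subseteq X$, writing $Y^c=X\setminus Y$, we have $$|Y| = |X|\left(1+2\,\frac{\mathbf{w}_{Y^c}^T(K^\dagger_{Y^cY^c})^{-1}\mathbf{w}_{Y^c}}{|X|}\right)^{-1}\quad\text{and}\quad \frac{\mathbf{w}'}{|Y|}=\frac{\mathbf{w}_Y}{|X|}-K^\dagger_{YY^c}(K^\dagger_{Y^cY^c})^{-1}\frac{\mathbf{w}_{Y^c}}{|X|},$$ where $\mathbf{w}$ is the weighting on $X$ and $\mathbf{w}'$ is the weighting on $Y$. Furthermore, $K^\dagger(Y)=K^\dagger(X)/Y^c$.
   Context: Metric spaces $(X,d)$ are finite and nonempty; subspaces $Y\subseteq X$ carry the restricted metric. The similarity matrix $Z=Z(X)\in\mathbb{R}^{X\times X}$ has entries $z_{ij}=e^{-d(i,j)}$; $X$ is positive definite if $Z$ is. Then the weighting on $X$ is $\mathbf{w}=Z^{-1}\mathbf{1}$ and the magnitude is $|X|=\mathbf{1}^T\mathbf{w}$ ($\mathbf{1}$ the all-ones vector); nonempty subspaces of positive definite spaces are positive definite. The centered similarity matrix is $K=K(X)=\tfrac12\big(I-\tfrac{\mathbf{1}\mathbf{1}^T}{n}\big)Z\big(I-\tfrac{\mathbf{1}\mathbf{1}^T}{n}\big)$ with $n=\#X$, and $K^\dagger=K^\dagger(X)$ is its Moore--Penrose pseudoinverse; $K^\dagger(Y)=K(Y)^\dagger$ is the corresponding matrix constructed from the metric space $Y$. Subscripts denote subvectors and submatrices: $M_{AB}$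 has rows indexed by $A$ and columns by $B$. For a matrix $M$ with rows and columns indexed by $X$ and $M_{Y^cY^c}$ invertible, the Schur complement is $M/Y^c:=M_{YY}-M_{YY^c}(M_{Y^cY^c})^{-1}M_{Y^cY}$. If $Y=X$, terms involving $Y^c=\emptyset$ are zero. *)

(* Defs.v *)
From mathcomp Require Import all_boot all_order all_algebra finmap.
From mathcomp Require Import boolp classical_sets reals topology sequences.

Set Implicit Arguments.
Unset Strict Implicit.
Unset Printing Implicit Defensive.

Import Order.TTheory GRing.Theory Num.Theory.
Local Open Scope fset_scope.
Local Open Scope ring_scope.

Definition ones {R : pzSemiRingType} n : 'cV[R]_n := const_mx 1.

Definition posdefmx {R : numDomainType} n (A : 'M[R]_n) : Prop :=
  A^T = A /\ forall v : 'cV[R]_n, v != 0 -> 0 < (v^T *m A *m v) 0 0.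

(* [pinvmx] of [mxalgebra] is only a one-sided partial inverse, not the
   Moore-Penrose pseudoinverse, hence the following. *)
Definition penrose {R : pzRingType} m n (A : 'M[R]_(m, n)) (B : 'M[R]_(n, m)) :
    Prop :=
  [/\ A *m B *m A = A, B *m A *m B = B,
      (A *m B)^T = A *m B & (B *m A)^T = B *m A].

Definition mppinv {R : realFieldType} m n (A : 'M[R]_(m, n)) : 'M[R]_(n, m) :=
  xget 0 [set B | penrose A B]%classic.

Lemma penrose_uniq (R : comPzRingType) m n (A : 'M[R]_(m, n)) B C :
  penrose A B -> penrose A C -> B = C.
Proof.
move=> [ABA BAB sAB sBA] [ACA CAC sAC sCA].
have eAB : A *m B = A *m C.
  have h : (A *m C) *m (A *m B) = A *m B by rewrite mulmxA ACA.
  by rewrite -h -{1}sAC -{1}sAB -trmx_mul mulmxA ABA sAC.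
have eBA : B *m A = C *m A.
  have h : (B *m A) *m (C *m A) = B *m A by rewrite -mulmxA (mulmxA A C A) ACA.
  by rewrite -h -{1}sCA -{1}sBA -trmx_mul -mulmxA (mulmxA A B A) ABA sCA.
by rewrite -BAB eBA -mulmxA eAB mulmxA CAC.
Qed.

Lemma mulmx_tr_eq0 (R : realFieldType) m n (A : 'M[R]_(m, n)) :
  A *m A^T = 0 -> A = 0.
Proof.
move=> AA0; apply/matrixP => i j; rewrite mxE.
have := congr1 (fun B : 'M_m => B i i) AA0; rewrite !mxE => /eqP.
rewrite psumr_eq0 => [/allP/(_ j (mem_index_enum j))|k _]; last first.
  by rewrite mxE -expr2 sqr_ge0.
by rewrite mxE -expr2 sqrf_eq0 => /eqP.
Qed.

Lemma row_free_gram_unit (R : realFieldType) m n (F : 'M[R]_(m, n)) :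
  row_free F -> F *m F^T \in unitmx.
Proof.
move=> Ff; rewrite -row_free_unit -kermx_eq0; apply/eqP.
have : kermx (F *m F^T) *m F = 0.
  apply: mulmx_tr_eq0.
  by rewrite trmx_mul mulmxA -(mulmxA _ F) mulmx_ker mul0mx.
by move/(canRL (mulmxKp Ff)); rewrite mul0mx.
Qed.

Lemma mppinvP (R : realFieldType) m n (A : 'M[R]_(m, n)) : penrose A (mppinv A).
Proof.
suff [B AB] : exists B, penrose A B.
  by rewrite /mppinv; case: xgetP => [C _ //|/(_ B)].
have [r [C [F [-> uF uC]]]] : exists r (C : 'M[R]_(m, r)) (F : 'M[R]_(r, n)),
    [/\ A = C *m F, F *m F^T \in unitmx & C^T *m C \in unitmx].
  exists (\rank A), (col_base A), (row_base A); split.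
  - by rewrite mulmx_base.
  - by apply: row_free_gram_unit; exact: row_base_free.
  - rewrite -{2}(trmxK (col_base A)); apply: row_free_gram_unit.
    by rewrite /row_free mxrank_tr; exact: col_base_full.
set B := F^T *m invmx (F *m F^T) *m invmx (C^T *m C) *m C^T.
have AB : C *m F *m B = C *m invmx (C^T *m C) *m C^T.
  by rewrite /B !mulmxA -(mulmxA C F) mulmxK.
have BA : B *m (C *m F) = F^T *m invmx (F *m F^T) *m F.
  by rewrite /B !mulmxA -(mulmxA _ C^T C) mulmxKV.
exists B; split.
- by rewrite AB !mulmxA -(mulmxA _ C^T C) mulmxKV.
- by rewrite BA /B !mulmxA -(mulmxA _ F F^T) mulmxKV.
- by rewrite AB !trmx_mul trmxK trmx_inv trmx_mul trmxK mulmxA.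
- by rewrite BA !trmx_mul trmxK trmx_inv trmx_mul trmxK mulmxA.
Qed.

(* A finite metric space is given as a finite set of points [X : {fset M}] of a
   metric space [M], with the metric restricted to [X]; the case [M = X] shows
   that this is no restriction. Matrices with rows and columns indexed by [X] are
   indexed by ['I_#|{: X}|], through [enum_val] on the finite type [X]. *)

Definition similarity {R : realType} {M : metricType R} (X : {fset M}) :
    'M[R]_#|{: X}| :=
  \matrix_(i, j) expR (- mdist (val (enum_val i)) (val (enum_val j))).

Definition weighting {R : realType} {M : metricType R} (X : {fset M}) :
    'cV[R]_#|{: X}| :=
  invmx (similarity X) *m ones _.

Definition magnitude {R : realType} {M : metricType R} (X : {fset M}) : R :=
  ((ones _)^T *m weighting X) 0 0.

Definition centering {R : fieldType} n : 'M[R]_n :=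
  1%:M - n%:R^-1 *: (ones n *m (ones n)^T).

Definition csim {R : realType} {M : metricType R} (X : {fset M}) :
    'M[R]_#|{: X}| :=
  2^-1 *: (centering _ *m similarity X *m centering _).

Definition csim_pinv {R : realType} {M : metricType R} (X : {fset M}) :
    'M[R]_#|{: X}| :=
  mppinv (csim X).

Definition sub_index {T : choiceType} (A X : {fset T}) (sAX : A `<=` X)
    (i : 'I_#|{: A}|) : 'I_#|{: X}| :=
  enum_rank (fincl sAX (enum_val i)).

Definition subvec {R : Type} {T : choiceType} (A X : {fset T}) (sAX : A `<=` X)
    (v : 'cV[R]_#|{: X}|) : 'cV[R]_#|{: A}| :=
  rowsub (sub_index sAX) v.

Definition submat {R : Type} {T : choiceType} (A B X : {fset T})
    (sAX : A `<=` X) (sBX : B `<=` X) (K : 'M[R]_#|{: X}|) :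
    'M[R]_(#|{: A}|, #|{: B}|) :=
  mxsub (sub_index sAX) (sub_index sBX) K.

(* [schur_compl sYX K] is K / (X \ Y). *)
Definition schur_compl {R : comUnitRingType} {T : choiceType} (X Y : {fset T})
    (sYX : Y `<=` X) (K : 'M[R]_#|{: X}|) : 'M[R]_#|{: Y}| :=
  let sYcX := fsubsetDl X Y in
  submat sYX sYX K
  - submat sYX sYcX K *m invmx (submat sYcX sYcX K) *m submat sYcX sYX K.

(* Main.v *)
Require Import Defs.
From mathcomp Require Import all_boot all_order all_algebra finmap.
From mathcomp Require Import reals topology.
From mathcomp Require Import ring.

(** Write [Z] for the similarity matrix of [X], [w] for its weighting, [m] for
its magnitude, and let [L = Z^-1 - m^-1 w w^T].  Two facts explain the theorem.

- [K^+ = 2 L] ([mppinv_centered]).  The matrix [L] kills the all-ones vector,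
  and [Z L = 1 - m^-1 1 w^T].  Hence [K (2 L)] and [(2 L) K] both equal the
  orthogonal projection off the all-ones vector, which yields the Penrose
  equations.

- The matrix [Z], bordered by a row and a column of ones and a zero corner, has
  as inverse the block matrix with blocks [L], [w / m], [w^T / m] and [- 1 / m]
  ([mul_bordered_inv]).  So one inverse matrix records the pseudoinverse, the
  normalized weighting and the magnitude together.

Bordering commutes with passing to a subspace: the bordered matrix of [Y] is the
principal submatrix of the bordered matrix of [X] on [Y] and the extra index.
For any invertible matrix, the inverse of an invertible principal submatrix is
the Schur complement, in the full inverse, of the complementary block
([invmx_mxsub_schur]); that block, here [L] restricted to the complement of [Y],
is automatically invertible.  Reading this identity off block by block
([centered_inv_mxsub]) gives the three formulas: the [Y]-[Y] block is the one for
[K^+], the border column is the one for the weighting, and the corner is the one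
for the magnitude.  Positive definiteness of [Z] passes to its submatrix on [Y], and
makes both matrices and both magnitudes invertible. *)

Import Order.TTheory GRing.Theory Num.Theory.
Set Implicit Arguments.
Unset Strict Implicit.
Unset Printing Implicit Defensive.

Local Open Scope fset_scope.
Local Open Scope ring_scope.

(** * Inverses of principal submatrices *)

Section Complementary.
Context {R : comUnitRingType}.

Definition copair_index k l n (f : 'I_k -> 'I_n) (g : 'I_l -> 'I_n)
    (u : 'I_k + 'I_l) : 'I_n :=
  match u with inl i => f i | inr j => g j end.

Definition complementary k l n (f : 'I_k -> 'I_n) (g : 'I_l -> 'I_n) :=
  bijective (copair_index f g).

Lemma mxsub_mul_complementary k l n p q p' q' (f : 'I_k -> 'I_n)
    (g : 'I_l -> 'I_n) (h : 'I_p' -> 'I_p) (h' : 'I_q' -> 'I_q)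
    (A : 'M[R]_(p, n)) (B : 'M[R]_(n, q)) :
  complementary f g ->
  mxsub h h' (A *m B) =
    mxsub h f A *m mxsub f h' B + mxsub h g A *m mxsub g h' B.
Proof.
move=> fg; apply/matrixP => i j; rewrite !mxE (reindex _ (onW_bij _ fg)) /=.
rewrite big_sumType /=; by congr (_ + _); apply: eq_bigr => t _; rewrite !mxE.
Qed.

Lemma mxsub1_inj k n (f : 'I_k -> 'I_n) :
  injective f -> mxsub f f (1%:M : 'M[R]_n) = 1%:M.
Proof. by move=> fI; apply/matrixP => i j; rewrite !mxE (inj_eq fI). Qed.

Lemma mxsub1_disjoint k l n (f : 'I_k -> 'I_n) (g : 'I_l -> 'I_n) :
  complementary f g -> mxsub f g (1%:M : 'M[R]_n) = 0.
Proof.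
move=> /bij_inj fgI; apply/matrixP => i j; rewrite !mxE.
by case: eqP => // fi_gj; have := fgI (inl i) (inr j) fi_gj.
Qed.

Lemma complementary_injl k l n (f : 'I_k -> 'I_n) (g : 'I_l -> 'I_n) :
  complementary f g -> injective f.
Proof. by move=> /bij_inj fgI i j fij; case: (fgI (inl i) (inl j) fij). Qed.

Lemma complementary_injr k l n (f : 'I_k -> 'I_n) (g : 'I_l -> 'I_n) :
  complementary f g -> injective g.
Proof. by move=> /bij_inj fgI i j fij; case: (fgI (inr i) (inr j) fij). Qed.

(** Split [G H = 1] along the two index sets.  The [f]-[g] block expresses
[mxsub f g H] through [mxsub g g H]; substituting this in the [g]-[g] block
exhibits a left inverse of [mxsub g g H], and the [f]-[f] block then says that
the Schur complement is a right inverse of [mxsub f f G]. *)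
Lemma invmx_mxsub_schur k l n (f : 'I_k -> 'I_n) (g : 'I_l -> 'I_n)
    (G H : 'M[R]_n) :
  complementary f g -> G *m H = 1%:M -> mxsub f f G \in unitmx ->
  mxsub g g H \in unitmx /\
  invmx (mxsub f f G) =
    mxsub f f H - mxsub f g H *m invmx (mxsub g g H) *m mxsub g f H.
Proof.
move=> fg GH1 uG.
have block r s (h : 'I_r -> 'I_n) (h' : 'I_s -> 'I_n) :=
  mxsub_mul_complementary h h' G H fg.
have:= block _ _ f f; have := block _ _ f g; have := block _ _ g g.
rewrite GH1 !mxsub1_inj ?mxsub1_disjoint //; last 2 first.
- exact: complementary_injl fg.
- exact: complementary_injr fg.
move=> egg efg eff.
have eq : mxsub f g H = - invmx (mxsub f f G) *m mxsub f g G *m mxsub g g H.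
  apply: (can_inj (mulKmx uG)); rewrite !mulNmx mulmxN -mulmxA mulKVmx //.
  by apply/eqP; rewrite -addr_eq0 -efg.
have uH : mxsub g g H \in unitmx.
  by have := esym egg; rewrite eq !mulmxA -mulmxDl => /mulmx1_unit [].
split=> //; apply: (can_inj (mulKmx uG)); rewrite mulmxV // eq mulmxBr.
rewrite mulmxK // mulmxA !mulNmx mulmxN mulKVmx //.
by rewrite mulNmx opprK.
Qed.

End Complementary.

(** * Bordering a matrix by ones *)

Section Border.
Context {R : fieldType}.

Definition border_index k n (f : 'I_k -> 'I_n) (i : 'I_(k + 1)) : 'I_(n + 1) :=
  match split i with inl j => lshift 1 (f j) | inr j => rshift n j end.

(** The extra index of the border always goes with the part that is kept, so the
complementary part is the same with or without the border. *)
Lemma complementary_border k l n (f : 'I_k -> 'I_n) (g : 'I_l -> 'I_n) :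
  complementary f g ->
  complementary (border_index f) (fun j => lshift 1 (g j)).
Proof.
move=> fg; have fI := complementary_injl fg.
have gI := complementary_injr fg.
apply: inj_card_bij; last first.
  have := bij_eq_card fg; rewrite !card_sum !card_ord => <-.
  by rewrite addnAC.
have fgI : injective (copair_index f g) := bij_inj fg.
have fgN i j : f i <> g j by move=> /(fgI (inl i) (inr j)).
rewrite /border_index => -[i|i] [j|j] /=.
- case: (splitP i) => i' ei; case: (splitP j) => j' ej.
  + move=> /lshift_inj/fI ij; congr inl; apply: val_inj.
    by rewrite /= ei ej ij.
  + by move=> /eqP; rewrite eq_lrshift.
  + by move=> /eqP; rewrite eq_rlshift.
  + by move=> _; congr inl; apply: val_inj; rewrite /= ei ej !ord1.
- case: (splitP i) => i' _; first by move=> /lshift_inj/fgN.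
  by move=> /eqP; rewrite eq_rlshift.
- case: (splitP j) => j' _; first by move=> /lshift_inj/esym/fgN.
  by move=> /eqP; rewrite eq_lrshift.
- by move=> /lshift_inj/gI ->.
Qed.

Lemma mxsub_border k l n (f : 'I_k -> 'I_n) (g : 'I_l -> 'I_n)
   (A : 'M[R]_n) b c d :
  [/\ mxsub (border_index f) (border_index f) (block_mx A b c d) =
        block_mx (mxsub f f A) (rowsub f b) (colsub f c) d,
      mxsub (border_index f) (fun j => lshift 1 (g j)) (block_mx A b c d) =
        col_mx (mxsub f g A) (colsub g c),
      mxsub (fun j => lshift 1 (g j)) (border_index f) (block_mx A b c d) =
        row_mx (mxsub g f A) (rowsub g b)
    & mxsub (fun j => lshift 1 (g j)) (fun j => lshift 1 (g j))
        (block_mx A b c d) = mxsub g g A].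
Proof.
split; apply/matrixP => i j; rewrite ?[mxsub _ _ _ i j]mxE /border_index.
- rewrite -[i in RHS]splitK -[j in RHS]splitK.
  by case: (split i) => i'; case: (split j) => j' /=;
    rewrite ?(block_mxEul, block_mxEur, block_mxEdl, block_mxEdr) ?mxE.
- rewrite -[i in RHS]splitK.
  by case: (split i) => i' /=;
    rewrite ?(block_mxEul, block_mxEdl, col_mxEu, col_mxEd) ?mxE.
- rewrite -[j in RHS]splitK.
  by case: (split j) => i' /=;
    rewrite ?(block_mxEul, block_mxEur, row_mxEl, row_mxEr) ?mxE.
- by rewrite block_mxEul.
Qed.

Definition mx_weighting n (Z : 'M[R]_n) : 'cV[R]_n := invmx Z *m ones n.
Definition mx_magnitude n (Z : 'M[R]_n) : R := ((ones n)^T *m mx_weighting Z) 0 0.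
(** For symmetric [Z] of nonzero magnitude, the inverse of [Z] corrected by the
rank-one term that makes its row and column sums vanish; twice this matrix is the pseudoinverse of the centered
matrix. *)
Definition centered_inv n (Z : 'M[R]_n) : 'M[R]_n :=
  invmx Z - (mx_magnitude Z)^-1 *: (mx_weighting Z *m (mx_weighting Z)^T).
Definition bordered n (Z : 'M[R]_n) : 'M[R]_(n + 1) :=
  block_mx Z (ones n) (ones n)^T 0.
Definition bordered_inv n (Z : 'M[R]_n) : 'M[R]_(n + 1) :=
  block_mx (centered_inv Z) ((mx_magnitude Z)^-1 *: mx_weighting Z)
    ((mx_magnitude Z)^-1 *: mx_weighting Z)^T (- (mx_magnitude Z)^-1)%:M.

Section Fixed.
Context (n : nat) (Z : 'M[R]_n).
Hypotheses (sZ : Z^T = Z) (uZ : Z \in unitmx) (m0 : mx_magnitude Z != 0).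
Let w := mx_weighting Z.
Let m := mx_magnitude Z.
Let L := centered_inv Z.

Lemma mulmx_weighting : Z *m w = ones n.
Proof. by rewrite /w /mx_weighting mulKVmx. Qed.

Lemma ones_mul_weighting : (ones n)^T *m w = m%:M.
Proof. exact: mx11_scalar. Qed.

Lemma ones_mul_invmx : (ones n)^T *m invmx Z = w^T.
Proof. by rewrite /w /mx_weighting trmx_mul trmx_inv sZ. Qed.

Lemma centered_inv_sym : L^T = L.
Proof.
by rewrite /L /centered_inv linearB linearZ /= trmx_mul trmxK trmx_inv sZ.
Qed.

Lemma ones_mul_centered_inv : (ones n)^T *m L = 0.
Proof.
rewrite /L /centered_inv mulmxBr ones_mul_invmx -scalemxAr mulmxA.
by rewrite ones_mul_weighting mul_scalar_mx scalerA mulVf // scale1r subrr.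
Qed.

Lemma mulmx_centered_inv : Z *m L = 1%:M - m^-1 *: (ones n *m w^T).
Proof.
by rewrite /L /centered_inv mulmxBr mulmxV // -scalemxAr mulmxA mulmx_weighting.
Qed.

Lemma mul_bordered_inv : bordered Z *m bordered_inv Z = 1%:M.
Proof.
rewrite mulmx_block !mul0mx !addr0 mulmx_centered_inv ones_mul_centered_inv.
rewrite [(_ *: _)^T]linearZ /= -!scalemxAr mulmx_weighting // ones_mul_weighting.
rewrite subrK mul_mx_scalar scaleNr subrr scale_scalar_mx mulVf //.
by rewrite -scalar_mx_block.
Qed.

Lemma bordered_unit : bordered Z \in unitmx.
Proof. by have [] := mulmx1_unit mul_bordered_inv. Qed.

Lemma invmx_bordered : invmx (bordered Z) = bordered_inv Z.
Proof.
apply: (can_inj (mulKmx bordered_unit)).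
by rewrite mulmxV ?bordered_unit // mul_bordered_inv.
Qed.

End Fixed.
End Border.

(** * The pseudoinverse of a centered matrix *)

Section Pinv.
Context {R : realFieldType} (n : nat) (Z : 'M[R]_n).
Hypotheses (n0 : (0 < n)%N) (sZ : Z^T = Z) (uZ : Z \in unitmx)
  (m0 : mx_magnitude Z != 0).
Let L := centered_inv Z.

Lemma centering_sym : (centering n : 'M[R]_n)^T = centering n.
Proof.
by rewrite /centering linearB linearZ /= trmx1 trmx_mul trmxK.
Qed.

Lemma ones_mul_centering : (ones n)^T *m (centering n : 'M[R]_n) = 0.
Proof.
rewrite /centering mulmxBr mulmx1 -scalemxAr mulmxA.
have -> : (ones n)^T *m ones n = n%:R%:M :> 'M[R]_1.
  apply/matrixP => i j; rewrite !ord1 !mxE (eq_bigr (fun=> 1)).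
    by rewrite sumr_const card_ord.
  by move=> k _; rewrite !mxE mulr1.
by rewrite mul_scalar_mx scalerA mulVf ?scale1r ?subrr // pnatr_eq0 -lt0n.
Qed.

Lemma centering_mul_ones : (centering n : 'M[R]_n) *m ones n = 0.
Proof.
by rewrite -[LHS]trmxK trmx_mul centering_sym ones_mul_centering trmx0.
Qed.

Lemma centering_id p (A : 'M[R]_(n, p)) :
  (ones n)^T *m A = 0 -> centering n *m A = A.
Proof.
move=> A0; rewrite /centering mulmxBl mul1mx -scalemxAl -mulmxA A0 mulmx0.
by rewrite scaler0 subr0.
Qed.

(** As [L] has zero column sums, the centering on the right of [Z] fixes it, while
the one on the left kills the rank-one error term in
[Z *m L = 1%:M - m^-1 *: (ones n *m w^T)].  Both products of the two matrices are
therefore the projection [centering n]. *)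
Lemma mppinv_centered :
  mppinv (2^-1 *: (centering n *m Z *m centering n)) = 2%:R *: L.
Proof.
set P := centering n; set K := 2^-1 *: _.
have PL : P *m L = L by apply: centering_id; apply: ones_mul_centered_inv.
have KL : K *m (2%:R *: L) = P.
  rewrite /K -scalemxAl -scalemxAr scalerA mulVf ?pnatr_eq0 // scale1r.
  rewrite -!mulmxA PL mulmx_centered_inv // mulmxBr mulmx1 -scalemxAr mulmxA.
  by rewrite centering_mul_ones mul0mx scaler0 subr0.
have PP : P *m P = P by apply: centering_id; apply: ones_mul_centering.
have sK : K^T = K.
  by rewrite /K linearZ /= !trmx_mul centering_sym sZ mulmxA.
have sL : (2%:R *: L)^T = 2%:R *: L by rewrite linearZ /= centered_inv_sym.
have LK : (2%:R *: L) *m K = P.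
  by rewrite -[LHS]trmxK trmx_mul sK sL KL centering_sym.
apply: penrose_uniq (mppinvP K) _; split; rewrite ?KL ?LK ?centering_sym //.
  by rewrite /K -scalemxAr !mulmxA PP.
by rewrite -scalemxAr PL.
Qed.

End Pinv.

(** * Principal submatrices of positive definite matrices *)

Section Posdef.
Context {R : realFieldType}.

Lemma posdefmx_unit n (Z : 'M[R]_n) : posdefmx Z -> Z \in unitmx.
Proof.
move=> [sZ pZ]; rewrite -row_free_unit -kermx_eq0; apply/eqP/row_matrixP => i.
rewrite row0; apply/eqP; apply: contraT => v0.
have := pZ (row i (kermx Z))^T; rewrite trmxK -row_mul mulmx_ker row0 mul0mx mxE.
by rewrite ltxx -trmx0 (inj_eq trmx_inj) => /(_ v0).
Qed.

(** The magnitude is the value of the quadratic form of [Z] at the weighting,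
because [Z] maps the weighting to the all-ones vector. *)
Lemma posdefmx_magnitude_gt0 n (Z : 'M[R]_n) :
  (0 < n)%N -> posdefmx Z -> 0 < mx_magnitude Z.
Proof.
case: n Z => // n Z _ pZ; have uZ := posdefmx_unit pZ; case: pZ => sZ pZ.
rewrite /mx_magnitude -(mulmx_weighting uZ) trmx_mul sZ; apply: pZ.
apply/eqP => w0; have := mulmx_weighting uZ; rewrite w0 mulmx0.
by move=> /matrixP/(_ 0 0)/eqP; rewrite !mxE eq_sym oner_eq0.
Qed.

Lemma posdefmx_mxsub k n (f : 'I_k -> 'I_n) (Z : 'M[R]_n) :
  injective f -> posdefmx Z -> posdefmx (mxsub f f Z).
Proof.
move=> fI [sZ pZ]; split; first by rewrite trmx_mxsub sZ.
move=> v v0; pose E : 'M[R]_(k, n) := rowsub f 1%:M.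
have EE : E *m E^T = 1%:M.
  by rewrite /E trmx_mxsub trmx1 -mxsub_mul mulmx1 mxsub1_inj.
have -> : mxsub f f Z = E *m Z *m E^T.
  by rewrite /E -rowsubE trmx_mxsub trmx1 -mxsub_mul mulmx1.
have := pZ (E^T *m v); rewrite trmx_mul trmxK !mulmxA; apply.
apply: contraNneq v0 => Ev0.
by rewrite -[v]mul1mx -EE -mulmxA Ev0 mulmx0.
Qed.

(** The block-by-block reading of [invmx_mxsub_schur] for the bordered matrix: its
principal submatrix is again a bordered matrix, so both sides are known in closed
form.  The corner block gives the magnitude up to sign. *)
Lemma centered_inv_mxsub k l n (f : 'I_k -> 'I_n) (g : 'I_l -> 'I_n)
    (Z : 'M[R]_n) (L := centered_inv Z) (m := mx_magnitude Z)
    (w := mx_weighting Z) (Zf := mxsub f f Z) :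
  (0 < k)%N -> complementary f g -> posdefmx Z ->
  let Q := invmx (mxsub g g L) in
  [/\ mxsub g g L \in unitmx,
      (mx_magnitude Zf)^-1 =
        m^-1 + m^-1 ^+ 2 * ((rowsub g w)^T *m Q *m rowsub g w) 0 0,
      (mx_magnitude Zf)^-1 *: mx_weighting Zf =
        m^-1 *: rowsub f w - mxsub f g L *m Q *m (m^-1 *: rowsub g w)
    & centered_inv Zf = mxsub f f L - mxsub f g L *m Q *m mxsub g f L].
Proof.
move=> k0 fg pZ Q; have pZf := posdefmx_mxsub (complementary_injl fg) pZ.
have n0 : (0 < n)%N.
  by case: (n) f {g w m L Z Zf pZ pZf Q fg} => // f; case: (f (Ordinal k0)).
have m0 := lt0r_neq0 (posdefmx_magnitude_gt0 n0 pZ).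
have mf0 := lt0r_neq0 (posdefmx_magnitude_gt0 k0 pZf).
have [uZ uZf] := (posdefmx_unit pZ, posdefmx_unit pZf).
have [sZ sZf] := (proj1 pZ, proj1 pZf).
have [Gff _ _ _] := mxsub_border f g Z (ones n) (ones n)^T 0.
have onesf p q (h : 'I_p -> 'I_q) : rowsub h (ones q) = ones p :> 'cV[R]_p.
  exact: mxsub_const.
rewrite -trmx_mxsub onesf in Gff.
have := invmx_mxsub_schur (complementary_border fg) (mul_bordered_inv sZ uZ m0).
rewrite [mxsub _ _ (bordered Z)]Gff -/(bordered _).
move=> /(_ (bordered_unit sZf uZf mf0)); rewrite (invmx_bordered sZf uZf mf0).
rewrite /bordered_inv.
have [-> -> -> ->] := mxsub_border f g L (m^-1 *: w) (m^-1 *: w)^T (- m^-1)%:M.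
rewrite -/L -/m -/w -/Q => -[uL].
rewrite mul_col_mx mul_col_row opp_block_mx add_block_mx.
move=> /eq_block_mx[eL ew _ em]; split=> //.
- have := congr1 (fun A : 'M_1 => A 0 0) em.
  rewrite -trmx_mxsub !linearZ /= -2!scalemxAl scalerN scalerA !mxE /= !mulr1n.
  by rewrite -opprD => /oppr_inj ->; rewrite expr2.
- by rewrite [LHS]ew !linearZ.
Qed.

End Posdef.

(** * Subspaces of a finite metric space *)

Lemma sub_index_inj (T : choiceType) (A X : {fset T}) (sAX : A `<=` X) :
  injective (sub_index sAX).
Proof. by move=> i j /enum_rank_inj /fincl_inj /enum_val_inj. Qed.

Lemma complementary_sub_index (T : choiceType) (X Y : {fset T}) (sYX : Y `<=` X) :
  complementary (sub_index sYX) (sub_index (fsubsetDl X Y)).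
Proof.
apply: inj_card_bij; last first.
  rewrite card_sum !card_ord.
  by rewrite -!cardfE cardfsDS // subnKC // fsubset_leq_card.
have disj i j : sub_index sYX i <> sub_index (fsubsetDl X Y) j.
  move=> /enum_rank_inj /(congr1 val) /= ij.
  have := valP (enum_val j); rewrite /= -ij inE => /andP[/negP + _]; apply.
  exact: valP (enum_val i).
move=> [i|i] [j|j] /= => [/sub_index_inj ->||/esym|/sub_index_inj ->] //.
- by move/disj.
- by move/disj.
Qed.

Unset Implicit Arguments.

Theorem theorem4p16 (R : realType) (M : metricType R) (X Y : {fset M})
    (X_neq0 : X != fset0) (X_posdef : posdefmx (similarity X))
    (Y_neq0 : Y != fset0) (sYX : Y `<=` X) :
  let sYcX : X `\` Y `<=` X := fsubsetDl X Y in
  let w := weighting X in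
  let w_Y := subvec sYX w in
  let w_Yc := subvec sYcX w in
  let w' := weighting Y in
  let K_YYc := submat sYX sYcX (csim_pinv X) in
  let K_YcYc := submat sYcX sYcX (csim_pinv X) in
  [/\ K_YcYc \in unitmx,
      magnitude Y = magnitude X *
        (1 + 2 * ((w_Yc^T *m invmx K_YcYc *m w_Yc) 0 0 / magnitude X))^-1,
      (magnitude Y)^-1 *: w' = (magnitude X)^-1 *: w_Y
        - K_YYc *m invmx K_YcYc *m ((magnitude X)^-1 *: w_Yc)
    & csim_pinv Y = schur_compl sYX (csim_pinv X)].
Proof.
move=> sYcX w w_Y w_Yc w'.
have card_gt0 (A : {fset M}) : A != fset0 -> (0 < #|{: A}|)%N.
  by rewrite -cardfs_gt0 cardfE.
have fg := complementary_sub_index sYX.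
have [X0 Y0] := (card_gt0 _ X_neq0, card_gt0 _ Y_neq0).
have ZY : similarity Y = mxsub (sub_index sYX) (sub_index sYX) (similarity X).
  by apply/matrixP => i j; rewrite !mxE /sub_index !enum_rankK.
have pY := posdefmx_mxsub (complementary_injl fg) X_posdef.
have [uL em ew eL] := centered_inv_mxsub Y0 fg X_posdef.
have pinvE (A : {fset M}) : A != fset0 -> posdefmx (similarity A) ->
    csim_pinv A = 2 *: centered_inv (similarity A).
  move=> /card_gt0 A0 pA; apply: mppinv_centered => //.
  - by case: pA.
  - exact: posdefmx_unit.
  - exact/lt0r_neq0/posdefmx_magnitude_gt0.
set L := centered_inv (similarity X) in uL em ew eL.
have u2 : (2 : R) \is a GRing.unit by rewrite unitfE pnatr_eq0.
have submatE (A B : {fset M}) (sAX : A `<=` X) (sBX : B `<=` X) :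
    submat sAX sBX (csim_pinv X) = 2 *: submat sAX sBX L.
  by rewrite pinvE //; exact: linearZ.
move=> K_YYc K_YcYc.
have uK : K_YcYc \in unitmx by rewrite /K_YcYc submatE unitmxZ.
have eKinv : invmx K_YcYc = 2^-1 *: invmx (submat sYcX sYcX L).
  by rewrite /K_YcYc submatE invmxZ // -submatE.
have KK : K_YYc *m invmx K_YcYc = submat sYX sYcX L *m invmx (submat sYcX sYcX L).
  by rewrite eKinv /K_YYc submatE -scalemxAl -scalemxAr scalerA divrr // scale1r.
split=> //.
- have mX0 : magnitude X != 0 := lt0r_neq0 (posdefmx_magnitude_gt0 X0 X_posdef).
  apply: invr_inj; rewrite invfM invrK eKinv -scalemxAr -scalemxAl [X in X / _]mxE.
  move: em; rewrite -ZY => ->.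
  (* The factor 2 of the statement cancels the one in K^+ = 2 L. *)
  have halve (a q : R) : a != 0 ->
    a^-1 + a^-1 ^+ 2 * q = a^-1 * (1 + 2 * (2^-1 * q / a)) by move=> a0; field.
  exact: halve.
- by rewrite KK -ew -ZY.
- rewrite /schur_compl -/sYcX -/K_YYc -/K_YcYc KK !submatE -scalemxAr -scalerBr.
  by rewrite pinvE ?ZY // eL.
Qed.
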